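(* Let $n\geq 1$ be an integer. Every sequence $S_1,\ldots,S_{n-1}$ of subsets of $\{1,2,\ldots,n\}$ satisfying $$\Bigl|\bigcup_{i=1}^{k}S_i\Bigr|\leq k\quad\text{for every } 1\leq k\leq n-1$$ is the encoding of a unique directed acyclic graph on the set of vertices $\{1,2,\ldots,n\}$.
   Context: A directed graph $G=(V,E)$ consists of a finite vertex set $V$ and an edge set $E\subseteq V\times V$. A directed acyclic graph (DAG) is a directed graph containing no directed cycles (in particular no loops). A vertex $v$ is an out-neighbor of $u$ if $(u,v)\in E$. A source is a vertex with no incoming edges. Each vertex of $V=\{1,2,\ldots,n\}$ is its own label. Let $G=(V,E)$ be a DAG with $V=\{1,2,\ldots,n\}$. The minimal source sequence $u_1,u_2,\ldots,u_n$ of $G$ is defined recursively: $u_1$ is the source of $G$ with the smallest label; for $2\leq i\leq n$, $u_i$ is the source with the smallest label in the graph obtained from $G$ by deleting the vertices $u_1,\ldots,u_{i-1}$. For $1\leq i\leq n$, let $S_{n-i}$ be the set of out-neighbors of $u_i$ in $G$ (so $S_0=\emptyset$ always). The sequence $S_1,S_2,\ldots,S_{n-1}$ is called the encoding of $G$. *)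

(* Defs.v *)
From mathcomp Require Import all_boot.

Set Implicit Arguments.
Unset Strict Implicit.
Unset Printing Implicit Defensive.

(* The vertex labelled v in {1, ..., n} is the ordinal of value v - 1 in 'I_n;
   only the order of the labels matters.  A directed graph on these vertices is
   given by its edge set E : {set 'I_n * 'I_n}. *)

Definition edge_rel n (E : {set 'I_n * 'I_n}) : rel 'I_n :=
  fun u v => (u, v) \in E.

(* The one-element cycle [:: v] is a loop at v. *)
Definition acyclic n (E : {set 'I_n * 'I_n}) : Prop :=
  forall c : seq 'I_n, ucycle (edge_rel E) c -> c = [::].

Definition out_neighbors n (E : {set 'I_n * 'I_n}) (u : 'I_n) : {set 'I_n} :=
  [set v | (u, v) \in E].

(* A is the set of vertices that have not been deleted from the graph. *)
Definition is_source n (E : {set 'I_n * 'I_n}) (A : {set 'I_n}) (v : 'I_n) :=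
  v \in A /\ forall w, w \in A -> (w, v) \notin E.

Definition is_min_source n (E : {set 'I_n * 'I_n}) (A : {set 'I_n})
    (v : 'I_n) : Prop :=
  is_source E A v /\ forall w, is_source E A w -> v <= w.

(* Sequences indexed from 1 are functions on nat; for u only the values
   u 1, ..., u n matter, and for S below only S 1, ..., S n.-1.
   index_iota 1 i is the list of the j such that 1 <= j < i. *)
Definition min_source_seq n (E : {set 'I_n * 'I_n}) (u : nat -> 'I_n) : Prop :=
  forall i, 1 <= i <= n ->
    is_min_source E [set v | v \notin [seq u j | j <- index_iota 1 i]] (u i).

(* When E is acyclic, u 1, ..., u n exist and are determined by E. The index
   i = n is left out because S_0 is not a term of the encoding. *)
Definition is_encoding n (E : {set 'I_n * 'I_n}) (S : nat -> {set 'I_n}) :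
    Prop :=
  exists2 u : nat -> 'I_n, min_source_seq E u &
    forall i, 1 <= i < n -> S (n - i) = out_neighbors E (u i).

(* Main.v *)
(** When u_1, ..., u_{i-1} have been deleted, the remaining vertices are
    u_i, ..., u_n, whose out-neighbors form S_1 ∪ ... ∪ S_{n-i} (as S_0 is
    empty). So u_i is the least vertex outside {u_1, ..., u_{i-1}} and outside
    S_1 ∪ ... ∪ S_{n-i}: the sequence S determines u, hence the graph.
    Conversely these two sets have at most (i - 1) + (n - i) < n elements
    together, so the greedy choice never gets stuck. *)

Require Import Defs.
From mathcomp Require Import all_boot.

(** Going once around a cycle, the rank would strictly increase and yet return to its initial
    value. *)
Lemma increasing_rank_acyclic n (E : {set 'I_n * 'I_n}) (r : 'I_n -> nat) :
  (forall v w, (v, w) \in E -> r v < r w) -> acyclic E.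
Proof.
move=> r_incr [//|v c] /andP[/= vc _]; exfalso.
have {vc} : path (relpre r ltn) v (rcons c v).
  by apply: sub_path vc => x y; apply: r_incr.
have r_trans : transitive (relpre r ltn) by move=> y x z; apply: ltn_trans.
move/(order_path_min r_trans)/allP/(_ v).
by rewrite mem_rcons mem_head /= ltnn => /(_ isT).
Qed.

Section GreedySequence.

Set Implicit Arguments.
Unset Strict Implicit.
Unset Printing Implicit Defensive.

Variables (n : nat) (S : nat -> {set 'I_n}).

Implicit Types (E : {set 'I_n * 'I_n}) (u : nat -> 'I_n).

Definition before u i : seq 'I_n := [seq u j | j <- index_iota 1 i].

Definition available u i : pred 'I_n :=
  fun v => (v \notin before u i) && (v \notin \bigcup_(1 <= k < (n - i).+1) S k).

Definition greedy_at u i : Prop :=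
  available u i (u i) /\ forall w, available u i w -> u i <= w.

Definition greedy u : Prop := forall i, 1 <= i <= n -> greedy_at u i.

Definition fresh u : Prop := forall i, 1 <= i <= n -> u i \notin before u i.

(** The guard [i < n] makes [u n] a sink, whatever value the function [S] takes at 0. *)
Definition encoded_by E u : Prop :=
  forall i v, 1 <= i <= n ->
    ((u i, v) \in E) = (i < n) && (v \in S (n - i)).

Lemma beforeP u i v :
  reflect (exists2 j, 1 <= j < i & v = u j) (v \in before u i).
Proof.
by apply: (iffP mapP) => -[j jlt ->]; exists j; move: jlt; rewrite // mem_index_iota.
Qed.

Lemma eq_before u u' i :
  (forall j, 1 <= j < i -> u j = u' j) -> before u i = before u' i.
Proof. by move=> uu'; apply/eq_in_map => j; rewrite mem_index_iota; apply: uu'. Qed.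

Lemma mem_bigcup_nat (m : nat) v :
  reflect (exists2 k, 1 <= k <= m & v \in S k)
          (v \in \bigcup_(1 <= k < m.+1) S k).
Proof.
rewrite big_tnth; apply: (iffP bigcupP) => [[k _ vk]|[k km vk]].
  exists (tnth (in_tuple (index_iota 1 m.+1)) k) => //.
  by have := mem_tnth k (in_tuple (index_iota 1 m.+1)); rewrite mem_index_iota ltnS.
have /tnthP[j kj] : k \in in_tuple (index_iota 1 m.+1) by rewrite mem_index_iota ltnS.
by exists j; rewrite // -kj.
Qed.

Lemma fresh_inj u i j :
  fresh u -> 1 <= i <= n -> 1 <= j <= n -> u i = u j -> i = j.
Proof.
move=> fu; wlog ij : i j / i < j.
  move=> H hi hj e; case: (ltngtP i j) => // ltij; first exact: H.
  by apply/esym/H.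
move=> /andP[i0 _] hj e; case/negP: (fu j hj).
by apply/beforeP; exists i; rewrite ?i0.
Qed.

(** Pigeonhole: [u 1], ..., [u n] are n distinct elements of a set of size n. *)
Lemma fresh_surj u v : fresh u -> exists2 i, 1 <= i <= n & v = u i.
Proof.
move=> fu.
have uniq_u : uniq (before u n.+1).
  rewrite map_inj_in_uniq ?iota_uniq // => i j; rewrite !mem_index_iota !ltnS.
  exact: fresh_inj.
have v_u : v \in before u n.+1.
  have := card_uniqP uniq_u; rewrite size_map size_iota subn1 /= => card_u.
  have /subset_leqif_card/leqifP : before u n.+1 \subset 'I_n by apply/subsetP.
  by rewrite card_u card_ord ltnn; case: ifP => // /subsetP/(_ v isT).
by case/beforeP: v_u => i; rewrite ltnS; exists i.
Qed.

Lemma fresh_notin_before u i j :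
  fresh u -> 1 <= i <= n -> 1 <= j <= n -> (u j \notin before u i) = (i <= j).
Proof.
move=> fu hi hj; rewrite leqNgt; congr (~~ _); apply/beforeP/idP => [[k hk e]|ji].
  rewrite (fresh_inj fu hj _ e); first by case/andP: hk.
  case/andP: hk => -> /ltnW/leq_trans; apply; by case/andP: hi.
by exists j => //; case/andP: hj => ->.
Qed.

(** The vertices left at stage [i] are the [u j] with [i <= j <= n]. Those with [j < n] have
    out-neighborhoods [S (n - j)], and [n - j] then runs through 1, ..., [n - i]. *)
Lemma is_source_available E u i v :
  fresh u -> encoded_by E u -> 1 <= i <= n ->
  is_source E [set w | w \notin before u i] v <-> available u i v.
Proof.
move=> fu Eu hi; rewrite /is_source /available inE; split.
  case=> -> no_edge; apply/mem_bigcup_nat => -[k /andP[k0 kn] vk].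
  have i0 : 0 < i by case/andP: hi.
  have kltn : k < n by apply: leq_ltn_trans kn _; rewrite ltn_subrL i0; case/andP: hi => _ /(leq_trans i0).
  have hnk : 1 <= n - k <= n by rewrite subn_gt0 kltn leq_subr.
  (* If [v] lies in [S k], then [u (n - k)] has an edge to [v], and it is not yet deleted because
     [k <= n - i]. *)
  have := no_edge (u (n - k)).
  rewrite inE fresh_notin_before // Eu // subKn ?(ltnW kltn) // vk.
  rewrite leq_subRL ?(ltnW kltn) // addnC -leq_subRL; last by case/andP: hi.
  by rewrite kn ltn_subrL k0 (leq_ltn_trans (leq0n _) kltn) => /(_ isT).
case/andP=> -> v_free; split=> // w; rewrite inE.
have [j hj ->] := fresh_surj w fu.
rewrite fresh_notin_before // Eu // => ij; apply: contra v_free => /andP[jn vj].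
by apply/mem_bigcup_nat; exists (n - j); rewrite // subn_gt0 jn leq_sub2l.
Qed.

Lemma min_source_seq_fresh E u : min_source_seq E u -> fresh u.
Proof. by move=> Eu i /Eu[[+ _] _]; rewrite inE. Qed.

Lemma greedy_fresh u : greedy u -> fresh u.
Proof. by move=> gu i /gu[/andP[]]. Qed.

Lemma min_source_seq_greedy E u :
  encoded_by E u -> min_source_seq E u <-> greedy u.
Proof.
move=> Eu; split=> Hu i hi.
  have src v := is_source_available v (min_source_seq_fresh Hu) Eu hi.
  by case: (Hu i hi) => /src ui umin; split=> // w /src; apply: umin.
have src v := is_source_available v (greedy_fresh Hu) Eu hi.
by case: (Hu i hi) => /src ui umin; split=> // w /src; apply: umin.
Qed.

(** If [j <= i], then [u i] is still present when [u j] is chosen as a source. *)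
Lemma min_source_seq_edge E u i j :
  min_source_seq E u -> 1 <= i <= n -> 1 <= j <= n ->
  (u i, u j) \in E -> i < j.
Proof.
move=> Eu hi hj; apply: contraTT; rewrite -leqNgt => ji.
case: (Eu j hj) => -[_ +] _; apply; rewrite inE.
by rewrite (fresh_notin_before (min_source_seq_fresh Eu)).
Qed.

Lemma min_source_seq_acyclic E u : min_source_seq E u -> acyclic E.
Proof.
move=> Eu; have [r r_bound ur] :=
  fin_all_exists2 (fun v => fresh_surj v (min_source_seq_fresh Eu)).
(* The rank of a vertex is its position in [u]. *)
apply: (@increasing_rank_acyclic _ _ r) => v w; rewrite [v in (v, _)]ur [w in (_, w)]ur.
exact: min_source_seq_edge.
Qed.

Lemma is_encoding_encoded_by E u :
  1 <= n -> min_source_seq E u ->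
  (forall i, 1 <= i < n -> S (n - i) = out_neighbors E (u i)) <->
  encoded_by E u.
Proof.
move=> n0 Eu; split=> [SE i v hi|Eenc i /andP[i0 ilen]]; last first.
  by apply/setP=> v; rewrite inE Eenc ?i0 ?(ltnW ilen) // ilen.
case: (ltnP i n) => [ilen|nlei].
  by rewrite SE ?inE //; case/andP: hi => ->.
(* Here [i = n], a case on which the encoding is silent: an edge from [u n] would have to lead to a
   later term of the sequence. *)
apply/negP; have [j hj ->] := fresh_surj v (min_source_seq_fresh Eu).
move/(min_source_seq_edge Eu hi hj); rewrite ltnNge (leq_trans _ nlei) //.
by case/andP: hj.
Qed.

Lemma greedy_at_eq u u' i :
  (forall j, 1 <= j < i -> u j = u' j) -> greedy_at u i -> greedy_at u' i ->
  u i = u' i.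
Proof.
rewrite /greedy_at /available => /eq_before-> [ui umin] [u'i u'min].
by apply/val_inj/eqP; rewrite eqn_leq umin ?u'min.
Qed.

Lemma greedy_unique u u' i :
  greedy u -> greedy u' -> 1 <= i <= n -> u i = u' i.
Proof.
move=> gu gu'; elim/ltn_ind: i => i IH hi.
apply: greedy_at_eq; [|exact: gu|exact: gu'] => j /andP[j0 ji].
by apply: IH; rewrite // j0 (leq_trans (ltnW ji)) //; case/andP: hi.
Qed.

Lemma encoded_by_unique E E' u u' :
  greedy u -> greedy u' -> encoded_by E u -> encoded_by E' u' -> E = E'.
Proof.
move=> gu gu' Eu Eu'; apply/setP=> -[v w].
have [i hi ->] := fresh_surj v (greedy_fresh gu).
by rewrite Eu // (greedy_unique gu gu' hi) Eu'.
Qed.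

(** Freshness gives each vertex a single index, so the prescribed out-neighborhoods cannot
    conflict. *)
Lemma encoded_by_exists u : fresh u -> exists E, encoded_by E u.
Proof.
move=> fu; exists [set p | [exists i : 'I_n,
  [&& 0 < i, u i == p.1 & p.2 \in S (n - i)]]] => i v hi; rewrite inE /=.
apply/existsP/andP => [[j /and3P[j0 /eqP/fresh_inj e vj]]|[ilen vi]].
  by rewrite -(e fu _ hi) ?j0 ?(ltnW (ltn_ord j)).
by exists (Ordinal ilen); rewrite /= eqxx vi !andbT; case/andP: hi.
Qed.

Hypothesis card_unions : forall k, 1 <= k <= n.-1 ->
  #|\bigcup_(1 <= i < k.+1) S i| <= k.

Lemma available_exists u i : 1 <= i <= n -> exists v, available u i v.
Proof.
case/andP=> i0 ilen.
pose U := \bigcup_(1 <= k < (n - i).+1) S k.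
have card_U : #|U| <= n - i.
  (* The cardinality hypothesis starts at [k = 1]; for [i = n] the union is empty. *)
  rewrite /U; case: (posnP (n - i)) => [->|ni0]; first by rewrite big_geq ?cards0.
  by apply: card_unions; rewrite ni0 -subn1 leq_sub2l.
suff /subsetPn[v _ v_free] : ~~ ([set: 'I_n] \subset [set w in before u i] :|: U).
  by exists v; move: v_free; rewrite !inE negb_or.
apply/negP => /subset_leq_card; rewrite cardsT card_ord leqNgt => /negP; apply.
have card_before : #|[set w in before u i]| <= i.-1.
  by rewrite cardsE (leq_trans (card_size _)) // size_map size_iota subn1.
apply: leq_ltn_trans (leq_card_setU _ _) _.
apply: leq_ltn_trans (leq_add card_before card_U) _.
by rewrite -[X in _ < X](subnKC ilen) ltn_add2r prednK.
Qed.

Lemma greedy_exists : 1 <= n -> exists u, greedy u.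
Proof.
move=> n0; suff /(_ n (leqnn n)) : forall m, m <= n ->
  exists u, forall i, 1 <= i <= m -> greedy_at u i by [].
elim=> [_|m IH mlen]; first by exists (fun=> Ordinal n0) => -[].
have [u gu] := IH (ltnW mlen).
have [v0 v0P] := @available_exists u m.+1 mlen.
case: (arg_minnP (fun v : 'I_n => v : nat) v0P) => v vP vmin.
(* Overwriting the value at [m.+1] is harmless: [greedy_at] at an index looks only at that value and
   the earlier ones. *)
pose u' i := if i == m.+1 then v else u i.
have before_u' i : i <= m.+1 -> before u' i = before u i.
  move=> im; apply: eq_before => j /andP[_ ji].
  by rewrite /u' ltn_eqF // (leq_trans ji).
exists u' => i /andP[i0 im]; rewrite /greedy_at /available before_u' // /u'.
case: eqP im => [-> //|/eqP neq]; rewrite leq_eqVlt (negPf neq) => im.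
by apply: gu; rewrite i0.
Qed.

End GreedySequence.

Theorem theorem2p2 (n : nat) (hn : 1 <= n) (S : nat -> {set 'I_n})
    (hS : forall k : nat, 1 <= k <= n.-1 ->
      #|\bigcup_(1 <= i < k.+1) S i| <= k) :
  exists! E : {set 'I_n * 'I_n}, acyclic E /\ is_encoding E S.
Proof.
have [u gu] := greedy_exists hS hn.
have [E Eu] := encoded_by_exists S (greedy_fresh gu).
have Emin : min_source_seq E u by apply/(min_source_seq_greedy Eu).
exists E; split=> [|E' [_ [u' E'min E'S]]].
  split; first exact: min_source_seq_acyclic Emin.
  by exists u => //; apply/(is_encoding_encoded_by S hn Emin).
(* Any competitor [E'] is also encoded along a greedy sequence for the same [S], so the two
   sequences coincide. *)
have Eu' : encoded_by S E' u' by apply/is_encoding_encoded_by.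
apply: (encoded_by_unique gu _ Eu Eu').
exact/(min_source_seq_greedy Eu').
Qed.
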